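(* Let $S\subseteq\omega_1$ be stationary and let $T=T(S)$. Then there is a subgraph $X$ of the comparability graph $G(T)$ with $Chr(X)=\omega_1$ such that $X$ contains no special cycles; in particular, $X$ contains no triangles and no subgraph isomorphic to $H_{\omega,\omega+2}$.
   Context: $T(S)$ denotes the tree of all closed (in the order topology of $\omega_1$) countable subsets $t\subseteq S$, ordered by $s\leq t$ iff $s$ is an initial segment of $t$. For a tree $(T,\leq)$, the comparability graph $G(T)$ has vertex set $T$ and an edge between distinct $x,y$ iff $x\leq y$ or $y\leq x$. $Chr(X)$ is the chromatic number. A path in a subgraph of $G(T)$ is monotone if its vertex set is a chain in $<_T$. A cycle $x_0,x_1,\dots,x_n=x_0$ in $G(T)$ is special if it is the union of two $<_T$-monotone paths. $H_{\omega,\omega+2}$ is the graph on vertices $\{x_i,y_i,z,z':i\in\mathbb N\}$ with edges $\{x_i,y_j\},\{x_i,z\},\{x_i,z'\}$ for all $i\leq j\in\mathbb N$.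
   Formalization: A monotone path is one whose vertices increase or decrease in <_T along the path; if its vertex set need only be a chain, every 4-cycle in G(T) is special, and by Erdős–Hajnal every uncountably chromatic graph contains a 4-cycle, so the claim would fail. *)

(* Defs.v *)
From HB Require Import structures.
From mathcomp Require Import all_boot all_order.
From mathcomp Require Import boolp classical_sets functions cardinality wochoice.
From mathcomp Require Import topology.

Set Implicit Arguments.
Unset Strict Implicit.
Unset Printing Implicit Defensive.

Local Open Scope classical_set_scope.
Local Open Scope order_scope.

(** ** The ordinal [omega_1]: a well-ordered set, with its order topology, that
    is uncountable while all its proper initial segments are countable.  This
    determines the order (hence the topology) up to a unique isomorphism. *)
Definition is_omega1 (d : Order.disp_t) (W : orderTopologicalType d) : Prop :=
  [/\ well_order (<=%O : rel W),
      ~ countable [set: W] &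
      forall a : W, countable [set x : W | x < a]].

Definition unbounded (d : Order.disp_t) (W : orderType d) (C : set W) : Prop :=
  forall a : W, exists2 b, C b & a < b.

Definition stationary (d : Order.disp_t) (W : orderTopologicalType d)
    (S : set W) : Prop :=
  forall C : set W, closed C -> unbounded C -> S `&` C !=set0.

Definition closed_subsets (d : Order.disp_t) (W : orderTopologicalType d)
    (S : set W) : set (set W) :=
  [set t | [/\ closed t, countable t & t `<=` S]].

Definition initial_segment (d : Order.disp_t) (W : orderType d) :
    rel (set W) :=
  fun s t =>
    `[< s `<=` t /\ forall x y : W, t x -> s y -> x <= y -> s x >].

(** ** Simple graphs, on a set of vertices that need not be a whole type *)
Record graph (U : Type) := Graph {
  verts : set U;
  adj : rel U;
  adj_sym : symmetric adj;
  adj_irrefl : irreflexive adj;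
  adj_verts : forall x y, adj x y -> verts x }.

Definition subgraph (U : Type) (X G : graph U) : Prop :=
  verts X `<=` verts G /\ forall x y, adj X x y -> adj G x y.

Definition graph_iso (U V : Type) (G : graph U) (H : graph V) : Prop :=
  exists2 f : U -> V, set_bij (verts G) (verts H) f &
    forall x y, verts G x -> verts G y -> adj G x y = adj H (f x) (f y).

Definition has_subgraph_iso (U V : Type) (G : graph U) (H : graph V) : Prop :=
  exists2 Y : graph U, subgraph Y G & graph_iso Y H.

Definition colorable (U : Type) (G : graph U) (C : Type) (D : set C) : Prop :=
  exists f : U -> C, (forall x, verts G x -> D (f x)) /\
                     (forall x y, adj G x y -> f x <> f y).

(** The chromatic number of [G] is the cardinality of [K]. *)
Definition chromatic_number (U : Type) (G : graph U) (T : Type) (K : set T)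
    : Prop :=
  colorable G K /\
  forall (C : Type) (D : set C), colorable G D -> (K #<= D)%card.

Definition has_triangle (U : Type) (G : graph U) : Prop :=
  exists x y z, [/\ adj G x y, adj G y z & adj G z x].

Section Comparability.
Variables (U : Type) (T : set U) (le : rel U).

Definition comparability_adj : rel U :=
  fun x y => `[< [/\ T x, T y, x <> y & le x y || le y x] >].

Lemma comparability_adj_sym : symmetric comparability_adj.
Proof.
by move=> x y; apply/asboolP/asboolP => -[Tx Ty xy];
  rewrite orbC => c; split=> //; apply/nesym.
Qed.

Lemma comparability_adj_irrefl : irreflexive comparability_adj.
Proof. by move=> x; apply/asboolP => -[]. Qed.

Lemma comparability_adj_verts x y : comparability_adj x y -> T x.
Proof. by move/asboolP => -[]. Qed.

Definition comparability_graph : graph U :=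
  Graph comparability_adj_sym comparability_adj_irrefl comparability_adj_verts.

End Comparability.

(** ** Paths, cycles and special cycles *)
Section SpecialCycles.
Variables (U : eqType) (le : rel U).
Implicit Types (G : graph U) (p q c : seq U).

Definition is_path G p : Prop :=
  [/\ p != [::], (forall x, x \in p -> verts G x), uniq p & sorted (adj G) p].

(** The edges [{x_i, x_(i+1)}] of the path [x_0, ..., x_n]. *)
Definition path_edge p : rel U :=
  fun u v => ((u, v) \in zip p (behead p)) || ((v, u) \in zip p (behead p)).

(** [c] lists [x_0, ..., x_(n-1)], the closing vertex [x_n = x_0] being left
    implicit. *)
Definition is_cycle G c : Prop := (2 < size c)%N /\ ucycle (adj G) c.

Definition cycle_edge c : rel U :=
  if c is x :: _ then path_edge (rcons c x) else fun _ _ => false.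

Definition lt_of : rel U := fun x y => (x != y) && le x y.

(** The vertices form a chain in the order in which the path visits them.  With
    the weaker condition that the vertices are pairwise comparable, every 4-cycle
    in the comparability graph of a tree would be the union of two monotone
    paths, and a graph without 4-cycles is countably chromatic. *)
Definition monotone p : Prop :=
  sorted lt_of p \/ sorted (fun x y => lt_of y x) p.

Definition special_cycle G c : Prop :=
  is_cycle G c /\
  exists p q,
    [/\ is_path G p /\ monotone p, is_path G q /\ monotone q,
        (forall x, (x \in c) = (x \in p) || (x \in q)) &
        forall x y, cycle_edge c x y = path_edge p x y || path_edge q x y].

End SpecialCycles.

(** ** The graph [H_{omega, omega+2}] *)
Inductive H_vertex : Type := Hx of nat | Hy of nat | Hz | Hz'.

Definition H_edge (u v : H_vertex) : bool :=
  match u, v with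
  | Hx i, Hy j => (i <= j)%N
  | Hx _, Hz | Hx _, Hz' => true
  | _, _ => false
  end.

Definition H_adj : rel H_vertex := fun u v => H_edge u v || H_edge v u.

Lemma H_adj_sym : symmetric H_adj.
Proof. by move=> u v; rewrite /H_adj orbC. Qed.

Lemma H_adj_irrefl : irreflexive H_adj.
Proof. by case. Qed.

Definition H_graph : graph H_vertex :=
  @Graph H_vertex setT H_adj H_adj_sym H_adj_irrefl (fun _ _ _ => I).

(* Main.v *)
(** Work in the tree of nonempty elements of [T(S)], and fix [phi : W -> W] with
    [S] unbounded in every fibre.  A ladder in [u] is an increasing sequence
    [kappa] of elements of [u] converging to [max u] with
    [phi (kappa i.+1) = kappa i]; for each [u] and each such [kappa], choose an
    end-extension [t = tau u kappa] of [u] from which [u] and [kappa] can be read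
    off, and join [t] to those initial segments [s] of [u] ending just below a rung
    [kappa i.+1] such that no descending walk from [s] passes below [kappa i].
    Walks that descend from [t] through different rungs then stay in disjoint
    intervals, so ascending walks are determined by their end points, which
    excludes special cycles.  As a rung determines the previous ones, two
    vertices have only finitely many common lower neighbours, which handles
    [H_(omega, omega+2)].

    For the chromatic number, let [f] be a colouring with countably many colours.
    [T(S)] is countably distributive, so some [ts] decides every colour [n]: either
    no vertex of colour [n] whose descending walks stay above [ts] lies above [ts],
    or such vertices exist relative to every extension of [ts].  Construct above
    [ts] some [u] and a ladder [kappa] picking up, rung by rung, a vertex of each
    colour of the second kind; the colour of [tau u kappa] is of the second kind,
    so it is repeated on an edge. *)

Require Import Defs.
From mathcomp Require Import all_boot all_order.
From mathcomp Require Import boolp classical_sets functions cardinality topology.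
From mathcomp Require Import interval wochoice.

Set Implicit Arguments.
Unset Strict Implicit.
Unset Printing Implicit Defensive.

Import Order.TTheory.

Local Open Scope classical_set_scope.
Local Open Scope order_scope.

(** * Countability and the order topology of omega_1 *)

Lemma countable_setU (T : Type) (A B : set T) :
  countable A -> countable B -> countable (A `|` B).
Proof.
move=> cA cB; apply: (@sub_countable _ _ _
    (\bigcup_(b in [set: bool]) (if b then A else B))).
  by apply: subset_card_le => x [Ax|Bx]; [exists true|exists false].
by apply: bigcup_countable => // -[].
Qed.

Section Omega1.
Context (d : Order.disp_t) (W : orderTopologicalType d) (hW : is_omega1 W).
Implicit Types (x y a b : W) (A : set W).

Lemma least (P : W -> Prop) :
  (exists x, P x) -> exists x, P x /\ forall y, P y -> x <= y.
Proof.
move=> [x Px]; have [wo _ _] := hW.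
have [|z [[zP zmin] _]] := wo [pred y | `[< P y >]].
  by exists x; apply/asboolP.
exists z; split; first exact/asboolP.
by move=> y Py; apply: zmin; apply/asboolP.
Qed.

Lemma wf_lt : well_founded (fun x y => x < y).
Proof.
move=> x; apply: contrapT => nx.
have [z [nz zmin]] := @least (fun y => ~ Acc (fun x y => x < y) y) (ex_intro _ x nx).
apply: nz; constructor => y yz; apply: contrapT => ny.
by have := zmin _ ny; rewrite leNgt yz.
Qed.

Lemma enum_below a : exists e : nat -> W, forall x, x < a -> exists n, e n = x.
Proof.
have [_ _ /(_ a) /countable_injP[f finj]] := hW.
exists (fun n => xget a [set x | x < a /\ f x = n]) => x xa; exists (f x).
case: xgetP => [y _ [ya fyx]|/(_ x)/(_ (conj xa erefl))//].
by apply: finj; rewrite ?inE.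
Qed.

Lemma countable_bounded A : countable A -> exists b, forall x, A x -> x < b.
Proof.
have [_ unc cnt] := hW => cA; apply: contrapT => nb; apply: unc.
have -> : [set: W] = \bigcup_(a in A) ([set x | x < a] `|` [set a]).
  apply/seteqP; split => // x _; apply: contrapT => nx; apply: nb.
  exists x => a Aa; rewrite ltNge le_eqVlt.
  by apply/negP => /orP[/eqP e|l]; apply: nx; exists a => //; [right|left].
apply: bigcup_countable => // a _.
exact: countable_setU.
Qed.

Lemma bounded_range (T : countType) (g : T -> W) : exists b, forall i, g i < b.
Proof.
have [|b hb] := @countable_bounded (range g).
  by apply: sub_countable (card_image_le _ _) _.
by exists b => i; apply: hb; exists i.
Qed.

Lemma above_two x y : exists b, x < b /\ y < b.
Proof.
have [b hb] := bounded_range (fun i : bool => if i then x else y).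
by exists b; split; [apply: (hb true)|apply: (hb false)].
Qed.

(* Limit points of a set are the limits from below, since every point has an
   immediate successor. *)
Lemma closedP A : closed A <->
  forall c, (exists2 x, A x & x <= c) ->
    (forall a, a < c -> exists2 x, A x & a < x <= c) -> A c.
Proof.
split=> [cA c [x0 Ax0 x0c] lim|lim].
  apply: cA => B; rewrite itv_nbhsE => -[i [oi ci] iB].
  suff [x Ax xi] : exists2 x, A x & x \in i by exists x; split => //; exact: iB.
  case: i oi ci {iB} => [[[] l|[]] [[] r|[]]] //= _; rewrite !in_itv /=.
  - move=> /andP[/lim [x Ax /andP[lx xc]] cr]; exists x => //.
    by rewrite in_itv /= lx (le_lt_trans xc).
  - by move=> /andP[/lim [x Ax /andP[lx xc]] _]; exists x => //; rewrite in_itv /= lx.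
  - by move=> cr; exists x0 => //; rewrite in_itv /= (le_lt_trans x0c).
  - by exists x0 => //; rewrite in_itv.
rewrite -(setCK A); apply: open_closedC; rewrite openE => c nAc.
have [c' [cc' c'min]] : exists c', c < c' /\ forall y, c < y -> c' <= y.
  by apply: least; have [b []] := above_two c c; exists b.
rewrite /interior /= itv_nbhsE.
have below x : x < c' -> x <= c.
  by move=> xc'; rewrite leNgt; apply/negP => /c'min; rewrite leNgt xc'.
case: (pselect (exists2 x, A x & x <= c)) => [lec|nx]; last first.
  exists `]-oo, c'[ => //=.
  by move=> x; rewrite /= in_itv /= => /below xc Ax; apply: nx; exists x.
have [a [ac na]] : exists a, a < c /\ ~ exists2 x, A x & a < x <= c.
  apply: contrapT => h; apply: nAc; apply: lim => // a ac.
  by apply: contrapT => na; apply: h; exists a.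
exists `]a, c'[ => /=; first by split=> //; rewrite in_itv /= ac.
move=> x; rewrite /= in_itv /= => /andP[ax /below xc] Ax.
by apply: na; exists x => //; rewrite ax.
Qed.

(** Well-founded recursion: the values already taken below [x] are countably many, so they cannot
    exhaust [D]. *)
Lemma uncountable_inj (C : Type) (D : set C) :
  ~ countable D -> exists h : W -> C, (forall x, D (h x)) /\ injective h.
Proof.
move=> unc.
have fresh x (g : forall y, y < x -> C) :
    exists c, D c /\ forall y (yx : y < x), g y yx <> c.
  have [e he] := enum_below x.
  apply: contrapT => nc; apply: unc.
  pose F n := [set c | exists p : e n < x, c = g (e n) p].
  apply: (@sub_countable _ _ _ (\bigcup_(n in [set: nat]) F n)).
    apply: subset_card_le => c Dc; apply: contrapT => nF.
    apply: nc; exists c; split=> // y yx gy; apply: nF.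
    by have [n en] := he y yx; exists n => //; subst y; exists yx.
  apply: bigcup_countable => // n _; rewrite /F.
  have [p|np] := pselect (e n < x).
    apply: (@sub_countable _ _ _ [set g (e n) p]) => //.
    by apply: subset_card_le => _ [q ->]; rewrite (Prop_irrelevance q p).
  by apply: (@sub_countable _ _ _ set0) => //; apply: subset_card_le => c [p].
pose h := Fix wf_lt (fun=> C) (fun x g => sval (cid (fresh x g))).
have hE x : h x = sval (cid (fresh x (fun y _ => h y))).
  rewrite /h Fix_eq // => {}x f g fg; congr (sval (cid (fresh _ _))).
  by apply: functional_extensionality_dep => y; apply/funext => p.
exists h; split => [x|x y].
  by rewrite hE; case: (cid _) => c [].
suff lt_neq u v : u < v -> h u <> h v.
  case: (ltgtP x y) => // [/lt_neq//|/lt_neq + e]; by rewrite e.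
by move=> uv; rewrite (hE v); case: (cid _) => /= c [_ /(_ u uv)].
Qed.

End Omega1.

(** * Stationary sets: omega-step constructions and unbounded fibres *)

Section Stationary.
Context (d : Order.disp_t) (W : orderTopologicalType d) (hW : is_omega1 W).
Context (S : set W) (hS : stationary S).
Implicit Types (x y b c : W).

(* With [op] choosing the steps, the points closed under all finite runs of [op]
   form a club. *)
Lemma chase (A : Type) (m : A -> W) (inv : A -> Prop)
    (R : nat -> A -> A -> Prop) (a0 : A) :
  inv a0 ->
  (forall k (a : A) b, inv a -> exists a', [/\ inv a', R k a a' & b < m a']) ->
  exists c, exists s : nat -> A,
    [/\ S c, s 0%N = a0,
        forall k, [/\ inv (s k), R k (s k) (s k.+1) & m (s k) < c] &
        forall x, x < c -> exists k, x < m (s k)].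
Proof.
move=> inv0 step.
have {step} /choice[op opP] : forall bka : W * nat * A, exists a',
    inv bka.2 -> [/\ inv a', R bka.1.2 bka.2 a' & bka.1.1 < m a'].
  move=> [[b k] a]; case: (pselect (inv a)) => [/(step k a b)[a' ?]|na].
    by exists a'.
  by exists a0.
pose run (w : seq (W * nat)) := foldr (fun bk a => op (bk, a)) a0 w.
pose below c (w : seq (W * nat)) := forall bk, bk \in w -> bk.1 < c.
pose C := [set c | forall w, below c w -> m (run w) < c].
have clC : closed C.
  apply/(closedP hW) => c [x0 Cx0 x0c] lim w wc.
  (* As [w] is finite, a single point of [C] at or below [c] already bounds all of it. *)
  suff [x [Cx xc]] : exists x, [/\ C x, x <= c & below x w].
    by move=> /Cx /lt_le_trans; apply.
  elim: w wc => [|[b k] w IH] wc; first by exists x0.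
  have [|x [Cx xc wx]] := IH; first by move=> y yw; apply: wc; rewrite inE yw orbT.
  have [|y Cy /andP[by_ yc]] := lim b; first exact: (wc _ (mem_head _ _)).
  have [xy|yx] := leP x y.
    exists y; split=> // z; rewrite inE => /predU1P[->//|/wx /lt_le_trans]; exact.
  exists x; split=> // z; rewrite inE => /predU1P[->/=|/wx//].
  exact: lt_trans yx.
have unbC : unbounded C.
  move=> a.
  have {}bd x : exists b, x < b /\ forall w, below x w -> m (run w) < b.
    (* Through [e], the finite runs with bounds below [x] are indexed by the countable type
       [seq (nat * nat)], so their values are bounded. *)
    have [e he] := enum_below hW x.
    have [b hb] := bounded_range hW
      (fun w : seq (nat * nat) => m (run [seq (e p.1, p.2) | p <- w])).
    have [b' [xb' bb']] := above_two hW x b; exists b'; split=> // w wx.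
    apply: lt_trans bb'; suff [v ->] : exists v, w = [seq (e p.1, p.2) | p <- v] by [].
    elim: w wx => [|[y k] w IH] wx; first by exists [::].
    have [|v ->] := IH; first by move=> z zw; apply: wx; rewrite inE zw orbT.
    have [n <-] := he y (wx _ (mem_head _ _)); by exists ((n, k) :: v).
  have [B hB] := choice bd.
  pose al n := iter n B a.
  have [c [alc cmin]] := least hW (bounded_range hW al).
  exists c; last exact: (alc 0%N).
  have almono n k : al n <= al (k + n)%N.
    elim: k => // k IH; apply: (le_trans IH); rewrite addSn /al iterS.
    exact: (ltW (hB _).1).
  move=> w wc; suff [n wn] : exists n, below (al n) w.
    by apply: lt_trans (alc n.+1); exact: (hB _).2.
  elim: w wc => [|[y k] w IH] wc; first by exists 0%N.
  have [|n wn] := IH; first by move=> z zw; apply: wc; rewrite inE zw orbT.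
  have [n' yn'] : exists n', y < al n'.
    apply: contrapT => h; have := wc _ (mem_head _ _); rewrite /= ltNge => /negP; apply.
    apply: cmin => i; rewrite ltNge; apply/negP => yi; apply: h.
    by exists i.+1; apply: (le_lt_trans yi); exact: (hB _).1.
  exists (n' + n)%N => z; rewrite inE => /predU1P[->/=|/wn].
    by rewrite addnC; exact: lt_le_trans (almono _ _).
  by move=> zn; exact: lt_le_trans (almono _ _).
have [c [Sc Cc]] := hS clC unbC.
have a0c : m a0 < c by exact: (Cc [::]).
have [e he] := enum_below hW c.
(* The enumeration [e] may leave the segment below [c]; replacing such values by [m a0] keeps every
   bound below [c], so [Cc] applies to each run, and still lists every [x < c]. *)
pose be k := if e k < c then e k else m a0.
have bec k : be k < c by rewrite /be; case: ifP.
pose s := fix s k := if k is k'.+1 then op (be k', k', s k') else a0.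
have sinv k : inv (s k) by elim: k => //= k /(opP (be k, k, s k))[].
have srun k : exists2 w, below c w & s k = run w.
  elim: k => [|k [w wc sw]]; first by exists [::].
  exists ((be k, k) :: w); last by rewrite /= sw.
  by move=> z; rewrite inE => /predU1P[->/=|/wc].
exists c, s; split=> // [k|x xc].
  have [_ Rk _] := opP (be k, k, s k) (sinv k).
  by split=> //; have [w wc ->] := srun k; exact: Cc.
have [k ek] := he x xc; exists k.+1.
by have [_ _] := opP (be k, k, s k) (sinv k); rewrite /= /be ek xc.
Qed.

Lemma stationary_unbounded b : exists2 c, S c & b < c.
Proof.
have [|k a b' _|c [s [Sc s0 sP _]]] := @chase W id (fun=> True) (fun _ _ _ => True) b.
- by [].
- by have [a' []] := above_two hW b' b'; exists a'.
- by exists c => //; have [_ _] := sP 0%N; rewrite s0.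
Qed.

(* Enumerate each initial segment in type [nat].  As in an Ulam matrix, some
   column takes uncountably many values unboundedly often on [S]. *)
Lemma unbounded_fibers : exists phi : W -> W,
  forall a b, exists c, [/\ S c, b < c & phi c = a].
Proof.
have [e he] := choice (enum_below hW).
have /choice[n hn] : forall a, exists n,
    forall b, exists c, [/\ S c, b < c & e c n = a].
  move=> a; apply: contrapT => h.
  have /choice[g hg] : forall n, exists b, forall c, S c -> b < c -> e c n <> a.
    move=> n; apply: contrapT => hb; apply: h; exists n => b.
    apply: contrapT => hc; apply: hb; exists b => c Sc bc ea.
    by apply: hc; exists c.
  have [b hb] := bounded_range hW g.
  (* Above [a], the enumeration of any later [c] must list [a] in some column. *)
  have [b' [bb' ab']] := above_two hW b a.
  have [c Sc b'c] := stationary_unbounded b'.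
  have [k ek] := he c a (lt_trans ab' b'c).
  exact: (hg k c Sc (lt_trans (hb k) (lt_trans bb' b'c)) ek).
have [N uncN] : exists N, ~ countable [set a | n a = N].
  apply: contrapT => h; have [_ unc _] := hW; apply: unc.
  have -> : [set: W] = \bigcup_(k in [set: nat]) [set a | n a = k].
    by apply/seteqP; split=> // x _; exists (n x).
  apply: bigcup_countable => // k _; apply: contrapT => hk; apply: h; by exists k.
have [h [hN hinj]] := uncountable_inj hW uncN.
(* Relabel the values of column [N] through the injection [h], so that all of [W] is attained; the
   default [c] is arbitrary. *)
exists (fun c => xget c [set a | h a = e c N]) => a b.
have [c [Sc bc ec]] := hn (h a) b; exists c; split=> //.
rewrite hN in ec; rewrite ec; case: xgetP => [y _ /hinj //|/(_ a)] /(_ erefl) [].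
Qed.

End Stationary.

(** * The initial-segment order *)

Section InitialSegments.
Context (d : Order.disp_t) (W : orderType d).
Implicit Types (s t u : set W).

Lemma init_refl t : initial_segment t t.
Proof. by apply/asboolP; split. Qed.

Lemma init_trans s t u :
  initial_segment s t -> initial_segment t u -> initial_segment s u.
Proof.
move=> /asboolP[st hst] /asboolP[tu htu]; apply/asboolP; split.
  by move=> x /st /tu.
by move=> x y ux sy xy; apply: (hst _ y) => //; apply: htu xy => //; exact: st.
Qed.

Lemma init_sub s t : initial_segment s t -> s `<=` t.
Proof. by move=> /asboolP[]. Qed.

Lemma init_le s t x y : initial_segment s t -> t x -> s y -> x <= y -> s x.
Proof. by move=> /asboolP[_]; exact. Qed.

Lemma init_anti s t : initial_segment s t -> initial_segment t s -> s = t.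
Proof. by move=> /init_sub st /init_sub ts; apply/seteqP. Qed.

Lemma cut_init t (b : W) : initial_segment (t `&` [set x | x < b]) t.
Proof.
apply/asboolP; split=> [x []//|x y tx [ty yb] xy].
by split=> //; exact: le_lt_trans yb.
Qed.

End InitialSegments.

(** * Nodes of the tree: maxima, one-point extensions and limits *)

Section Nodes.
Context (d : Order.disp_t) (W : orderTopologicalType d) (hW : is_omega1 W).
Context (S : set W) (w0 : W).
Implicit Types (x y a b c : W) (s t u : set W).

Local Notation init := (@initial_segment d W).

Definition node t := closed_subsets S t /\ t !=set0.

Definition is_top t c := t c /\ forall x, t x -> x <= c.

Definition top t := xget w0 [set c | is_top t c].

Lemma is_top_uniq t b c : is_top t b -> is_top t c -> b = c.
Proof. by move=> [tb hb] [tc hc]; apply/le_anti; rewrite hc// hb. Qed.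

Lemma topE t c : is_top t c -> top t = c.
Proof.
by move=> tc; rewrite /top; case: xgetP => [b _ /is_top_uniq/(_ tc)|/(_ c)].
Qed.

(** Countability bounds [t], and its least upper bound meets the criterion of [closedP]. *)
Lemma node_is_top t : node t -> is_top t (top t).
Proof.
move=> [[clt cnt _] [x0 tx0]].
have [b hb] := countable_bounded hW cnt.
have [c [tc cmin]] : exists c, (forall x, t x -> x <= c) /\
    forall y, (forall x, t x -> x <= y) -> c <= y.
  by apply: (least hW); exists b => x /hb /ltW.
suff tt : t c by rewrite (@topE _ c).
apply: ((closedP hW _).1 clt); first by exists x0 => //; exact: tc.
move=> a ac; apply: contrapT => h.
suff : c <= a by rewrite leNgt ac.
apply: cmin => x tx; rewrite leNgt; apply/negP => ax; apply: h.
by exists x => //; rewrite ax tc.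
Qed.

Lemma top_in t : node t -> t (top t).
Proof. by move=> /node_is_top[]. Qed.

Lemma le_top t x : node t -> t x -> x <= top t.
Proof. by move=> /node_is_top[_]; exact. Qed.

Lemma node_sub t x : node t -> t x -> S x.
Proof. by move=> [[_ _]] h _; exact: h. Qed.

Lemma init_top s t : node s -> node t -> init s t -> top s <= top t.
Proof.
by move=> ns nt st; apply: le_top => //; apply: (init_sub st); exact: top_in.
Qed.

Lemma init_below_top s t x : node s -> init s t -> t x -> x <= top s -> s x.
Proof. by move=> ns st tx; apply: init_le st tx _; exact: top_in. Qed.

Lemma node_add t c : node t -> S c -> top t < c ->
  [/\ node (t `|` [set c]), init t (t `|` [set c]) & top (t `|` [set c]) = c].
Proof.
move=> nt Sc tc; have [[clt cnt tS] [x0 tx0]] := nt.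
split.
- split; last by exists c; right.
  split; [|exact: countable_setU|by move=> x [/tS//|->]].
  apply/(closedP hW) => p [x Ax xp] lim; have [pc|cp|->] := ltgtP p c; last by right.
    have inl y : (t `|` [set c]) y -> y <= p -> t y.
      by case=> // -> cp; move: pc; rewrite ltNge cp.
    left; apply: ((closedP hW _).1 clt); first by exists x => //; exact: inl xp.
    move=> a /lim [y Ay /andP[ay yp]]; exists y; rewrite ?ay ?yp //.
    exact: inl yp.
  have [y [ty|->] /andP[cy _]] := lim c cp.
    by have := le_top nt ty; rewrite leNgt (lt_trans tc).
  by move: cy; rewrite ltxx.
- apply/asboolP; split; first by left.
  move=> x y [//|->] ty cy; have := le_top nt ty.
  by rewrite leNgt (lt_le_trans tc cy).
- apply: topE; split; first by right.
  by move=> x [tx|->//]; apply: le_trans (le_top nt tx) (ltW tc).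
Qed.

Lemma node1 c : S c -> node [set c].
Proof.
move=> Sc; split; last by exists c.
split=> [||_ ->] //; apply/(closedP hW) => p [x -> xp] lim.
apply/le_anti; rewrite xp andbT leNgt; apply/negP => /lim [y -> /andP[]].
by rewrite ltxx.
Qed.

Lemma chain_init (f : nat -> set W) i j :
  (forall k, init (f k) (f k.+1)) -> (i <= j)%N -> init (f i) (f j).
Proof.
move=> h /subnKC <-; elim: (j - i)%N => [|k IH]; first by rewrite addn0 init_refl.
by rewrite addnS; exact: init_trans IH _.
Qed.

(** A point below [c] lies under some [top (f k)], where [u] agrees with the closed set [f k]; the
    only new limit is [c] itself, which is in [S]. *)
Lemma node_limit (f : nat -> set W) c :
  S c -> (forall k, node (f k)) -> (forall k, init (f k) (f k.+1)) ->
  (forall k, top (f k) < c) ->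
  (forall x, x < c -> exists k, x < top (f k)) ->
  let u := (\bigcup_k f k) `|` [set c] in
  [/\ node u, forall k, init (f k) u & top u = c].
Proof.
move=> Sc nf fi fc cof u.
have ltc x k : f k x -> x < c.
  by move=> fx; exact: le_lt_trans (le_top (nf k) fx) (fc k).
have fu k : init (f k) u.
  apply/asboolP; split; first by move=> x fx; left; exists k.
  move=> x y [[j _ fx] fy xy|-> fy cy]; last first.
    by have := ltc _ _ fy; rewrite ltNge cy.
  have [kj|jk] := leqP k j; first exact: init_le (chain_init fi kj) fx fy xy.
  exact: (init_sub (chain_init fi (ltnW jk))).
split=> //; last first.
  by apply: topE; split; [right|move=> x [[k _ /ltc/ltW]//|->]].
split; last by exists c; right.
split.
- apply/(closedP hW) => p [x Ax xp] lim; have [pc|cp|->] := ltgtP p c; last by right.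
    have [k pk] := cof p pc.
    have inl y : u y -> y <= p -> f k y.
      move=> uy yp; apply: (init_below_top (nf k) (fu k) uy).
      exact: le_trans yp (ltW pk).
    left; exists k => //; have [[clt _ _] _] := nf k.
    apply: ((closedP hW _).1 clt); first by exists x => //; exact: inl xp.
    move=> a /lim [y Ay /andP[ay yp]]; exists y; rewrite ?ay ?yp //.
    exact: inl yp.
  have [y [[k _ /ltc yc]|->] /andP[cy _]] := lim c cp.
    by move: (lt_trans cy yc); rewrite ltxx.
  by move: cy; rewrite ltxx.
- apply: countable_setU => //; apply: bigcup_countable => // k _.
  by have [[]] := nf k.
- by move=> x [[k _ /(node_sub (nf k))]//|->].
Qed.

End Nodes.

(** * Distributivity, ladders and codes *)

Section Names.
Context (d : Order.disp_t) (W : orderTopologicalType d) (hW : is_omega1 W).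
Context (S : set W) (hS : stationary S) (w0 : W).
Context (phi : W -> W).
Implicit Types (x y a b c : W) (s t u : set W) (kappa : nat -> W).

Local Notation init := (@initial_segment d W).
Local Notation node := (node S).
Local Notation top := (top w0).

Lemma node_extend t b : node t -> exists t', [/\ node t', init t t' & b < top t'].
Proof.
move=> nt; have [b' [bb' tb']] := above_two hW b (top t).
have [c Sc b'c] := stationary_unbounded hW hS b'.
have [nt' tt' et'] := node_add hW nt Sc (lt_trans tb' b'c).
by exists (t `|` [set c]); split=> //; rewrite et' (lt_trans bb').
Qed.

(** [chase] meets [D k] at stage [k] while the tops converge to a point of [S], so the union closes
    up to a node above all stages. *)
Lemma distributive (D : nat -> set W -> Prop) t0 : node t0 ->
  (forall k t, node t -> exists t', [/\ node t', init t t' & D k t']) ->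
  (forall k t t', node t -> node t' -> init t t' -> D k t -> D k t') ->
  exists t, [/\ node t, init t0 t & forall k, D k t].
Proof.
move=> nt0 dense op.
have [//|k t b nt|c [f [Sc f0 fP cof]]] :=
  @chase _ _ hW _ hS _ top node (fun k t t' => init t t' /\ D k t') t0.
  have [t1 [nt1 tt1 Dt1]] := dense k t nt.
  have [t2 [nt2 t12 bt2]] := node_extend b nt1.
  exists t2; split=> //; split; first exact: init_trans t12.
  exact: op Dt1.
have nf k : node (f k) by case: (fP k).
have fi k : init (f k) (f k.+1) by case: (fP k) => _ [].
have fc k : top (f k) < c by case: (fP k).
have [nu fu _] := node_limit hW Sc nf fi fc cof.
exists (\bigcup_k f k `|` [set c]); split=> //; first by rewrite -f0.
move=> k; have [_ [_ Dk] _] := fP k.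
exact: op (nf k.+1) nu (fu k.+1) Dk.
Qed.

(* Only the elements of [t] close to its top matter, so any node has an extension
   with a prescribed code. *)
Definition code t : set W := [set a | forall x, x < top t ->
  exists c, [/\ t c, x < c, c < top t & phi c = a]].

(* The element [u] with a ladder [kappa] in it; as [phi] sends each rung to the
   previous one, a rung determines all the rungs below it. *)
Record name u kappa : Prop := Name {
  name_node : node u;
  name_in : forall i, u (kappa i);
  name_incr : forall i, kappa i < kappa i.+1;
  name_succ : forall i, phi (kappa i.+1) = kappa i;
  name_zero : phi (kappa 0%N) = w0 /\ w0 < kappa 0%N;
  name_lt : forall i, kappa i < top u;
  name_cofinal : forall x, x < top u -> exists i, x < kappa i }.

Lemma name_lt_mono u kappa i j : name u kappa -> (i < j)%N -> kappa i < kappa j.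
Proof.
move=> nk; apply: (@homo_ltn _ kappa (fun x y => x < y)) => [y x z|k].
  exact: lt_trans.
exact: name_incr nk k.
Qed.

Lemma name_le_mono u kappa i j : name u kappa -> (i <= j)%N -> kappa i <= kappa j.
Proof.
move=> nk; rewrite leq_eqVlt => /predU1P[->//|/(name_lt_mono nk)/ltW //].
Qed.

Lemma name_lt_inj u kappa i j : name u kappa -> kappa i < kappa j -> (i < j)%N.
Proof.
move=> nk ij; rewrite ltnNge; apply/negP => /(name_le_mono nk).
by rewrite leNgt ij.
Qed.

Lemma name_above u kappa i : name u kappa -> w0 < kappa i.
Proof.
by move=> nk; exact: lt_le_trans (name_zero nk).2 (name_le_mono nk (leq0n i)).
Qed.

(** Iterating [phi] from a rung descends the ladder until it reaches [w0], which lies below every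
    rung; hence the rung determines its own index and all rungs under it. *)
Lemma name_rungs u u' kappa lambda i j : name u kappa -> name u' lambda ->
  kappa i = lambda j -> i = j /\ forall k, (k <= i)%N -> kappa k = lambda k.
Proof.
move=> nk nl; elim: i j => [|i IH] [|j] e.
- by split=> // k; rewrite leqn0 => /eqP->.
- have := name_above j nl.
  by rewrite -(name_succ nl) -e (name_zero nk).1 ltxx.
- have := name_above i nk.
  by rewrite -(name_succ nk) e (name_zero nl).1 ltxx.
have [|ij h] := IH j; first by rewrite -(name_succ nk) e (name_succ nl).
by subst j; split=> // k; rewrite leq_eqVlt => /predU1P[->//|/h].
Qed.

Lemma name_top u u' kappa : name u kappa -> name u' kappa -> top u = top u'.
Proof.
move=> nk nl; apply/le_anti/andP; split; rewrite leNgt; apply/negP.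
  by move=> /(name_cofinal nk)[i]; apply/negP; rewrite -leNgt (ltW (name_lt nl i)).
by move=> /(name_cofinal nl)[i]; apply/negP; rewrite -leNgt (ltW (name_lt nk i)).
Qed.

(** Points with prescribed [phi]-values are added on top of [u]. The index [logn 2 k.+1] takes every
    value infinitely often, so each rung is coded cofinally. *)
Lemma exists_code u kappa : (forall a b, exists c, [/\ S c, b < c & phi c = a]) ->
  name u kappa -> exists t, [/\ node t, init u t & code t = range kappa].
Proof.
move=> phiP nk; have nu := name_node nk.
pose R k t t' := exists c, [/\ S c, top t < c, phi c = kappa (logn 2 k.+1) &
  t' = t `|` [set c]].
have [//|k t b nt|c [f [Sc f0 fP cof]]] := @chase _ _ hW _ hS _ top node R u.
  have [b' [bb' tb']] := above_two hW b (top t).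
  have [c [Sc b'c pc]] := phiP (kappa (logn 2 k.+1)) b'.
  have tc : top t < c by exact: lt_trans b'c.
  have [nt' tt' et'] := node_add hW nt Sc tc.
  exists (t `|` [set c]); rewrite et' (lt_trans bb') //; split=> //.
  by exists c.
have nf k : node (f k) by case: (fP k).
have fi k : init (f k) (f k.+1).
  case: (fP k) => _ [e [Se te _ ->]] _.
  by have [] := node_add hW (nf k) Se te.
have fc k : top (f k) < c by case: (fP k).
have [nt ft topt] := node_limit hW Sc nf fi fc cof.
exists (\bigcup_k f k `|` [set c]); split=> //; first by rewrite -f0.
apply/seteqP; rewrite /code topt; split=> a.
  move=> /(_ (top u)); rewrite -{1}f0 => /(_ (fc 0%N)) [e [te ue ec <-]].
  have [k fe] : exists k, f k e.
    by case: te => [[k _ fe]|ee]; [exists k | move: ec; rewrite ee ltxx].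
  elim: k fe => [|k IH]; first by rewrite f0 => /(le_top hW w0 nu); rewrite leNgt ue.
  have [_ [e' [_ _ pe' ->]] _] := fP k.
  by case=> [/IH//|->]; rewrite pe'; exists (logn 2 k.+1).
move=> [i _ <-] x /cof [k0 xk0].
(* The odd factor makes the 2-adic valuation of [n.+1] equal to [i], and it is large enough for
   stage [n] to come after stage [k0]. *)
pose n := (2 ^ i * k0.*2.+1).-1.
have n1 : n.+1 = (2 ^ i * k0.*2.+1)%N by rewrite prednK // muln_gt0 expn_gt0.
have k0n : (k0 <= n)%N.
  rewrite -ltnS n1; apply: (@leq_trans k0.*2.+1); last by rewrite leq_pmull ?expn_gt0.
  by rewrite ltnS -addnn leq_addr.
have ln : logn 2 n.+1 = i.
  by rewrite n1 lognM ?expn_gt0 // pfactorK // lognE /= dvdn2 /= odd_double /= addn0.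
have [_ [e [Se te pe fE]] _] := fP n.
have [_ _ etop] := node_add hW (nf n) Se te.
exists e; split.
- by left; exists n.+1 => //; rewrite fE; right.
- apply: lt_trans te; apply: lt_le_trans xk0 _.
  exact: init_top (nf _) (nf _) (chain_init fi k0n).
- by have := fc n.+1; rewrite fE etop.
- by rewrite pe ln.
Qed.

End Names.

(** * The ladder graph: walks and common lower neighbours *)

Section LadderGraph.
Context (d : Order.disp_t) (W : orderTopologicalType d) (hW : is_omega1 W).
Context (S : set W) (w0 : W) (phi : W -> W).
Context (tau : set W -> (nat -> W) -> set W).

Implicit Types (s t u v : set W) (kappa lambda : nat -> W).

Local Notation init := (@initial_segment d W).
Local Notation node := (node S).
Local Notation top := (top w0).
Local Notation name := (name S w0 phi).

Hypothesis tauP : forall u kappa, name u kappa ->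
  [/\ node (tau u kappa), init u (tau u kappa) &
      code w0 phi (tau u kappa) = range kappa].

(** The code recovers the ladder, since a set of rungs can be ordered in one way only by
    [name_rungs]. The ladder gives the common top of [u] and [u'], and both are the part of the same
    node up to that top. *)
Lemma tau_inj u u' kappa lambda : name u kappa -> name u' lambda ->
  tau u kappa = tau u' lambda -> u = u' /\ kappa = lambda.
Proof.
move=> nk nl e; have [_ iu ck] := tauP nk; have [_ iu' cl] := tauP nl.
have rg : range kappa = range lambda by rewrite -ck e cl.
have kl : kappa = lambda.
  apply/funext => i.
  have [j _ /esym ij] : range lambda (kappa i) by rewrite -rg; exists i.
  by have [_ h] := name_rungs nk nl ij; exact: h.
split=> //; subst lambda.
have uu := name_top nk nl.
have nu := name_node nk; have nu' := name_node nl.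
apply/seteqP; split=> x ux.
  apply: (init_below_top hW (w0 := w0) nu' iu'); first by rewrite -e; exact: (init_sub iu).
  by rewrite -uu; exact: (le_top hW w0 nu).
apply: (init_below_top hW (w0 := w0) nu iu); first by rewrite e; exact: (init_sub iu').
by rewrite uu; exact: (le_top hW w0 nu').
Qed.

(* [edge_guard] keeps every descending walk from [s] above the previous rung
   [kappa i]: see [walk_ge]. *)
Record edge_at u kappa i s t : Prop := EdgeAt {
  edge_name : name u kappa;
  edge_up : t = tau u kappa;
  edge_down : s = u `&` [set x | x < kappa i.+1];
  edge_node : node s;
  edge_guard : forall v lambda, name v lambda -> s = tau v lambda ->
    kappa i <= lambda 0%N }.

Definition edge s t := exists u kappa i, edge_at u kappa i s t.

Lemma edge_nodes s t : edge s t -> node s /\ node t.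
Proof.
by move=> [u [k [i [nk -> _ ns _]]]]; split=> //; have [] := tauP nk.
Qed.

Lemma edge_init s t : edge s t -> init s t.
Proof.
move=> [u [k [i [nk -> -> _ _]]]]; have [_ iu _] := tauP nk.
exact: init_trans (cut_init _ _) iu.
Qed.

Lemma edge_top_lt u kappa i s t : edge_at u kappa i s t -> top s < kappa i.+1.
Proof.
by move=> [nk _ sE ns _]; have := top_in hW w0 ns; rewrite {1}sE => -[].
Qed.

Lemma edge_top_ge u kappa i s t : edge_at u kappa i s t -> kappa i <= top s.
Proof.
move=> [nk _ sE ns _]; apply: (le_top hW w0 ns); rewrite sE.
by split; [exact: name_in nk i|exact: name_incr nk i].
Qed.

Lemma edge_lt s t : edge s t -> top s < top t.
Proof.
move=> e; have [ns nt] := edge_nodes e; move: e => [u [k [i e]]].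
apply: lt_le_trans (edge_top_lt e) _; apply: (le_top hW w0 nt).
case: e => nk -> _ _ _; have [_ iu _] := tauP nk.
by apply: (init_sub iu); exact: name_in nk _.
Qed.

Local Notation walk := (path (fun s t => `[< edge s t >])).

Lemma walk_le x p : walk x p -> top x <= top (last x p).
Proof.
elim/last_ind: p => //= p y IH; rewrite rcons_path last_rcons => /andP[/IH xp /asboolP].
by move=> /edge_lt/ltW; exact: le_trans.
Qed.

(** Descend from the upper end: [edge_guard] puts the whole next ladder at or above [kappa i], and
    the induction hypothesis bounds [top x] by a rung of that ladder. *)
Lemma walk_ge x p y u kappa i : walk x p -> edge_at u kappa i (last x p) y ->
  kappa i <= top x.
Proof.
elim/last_ind: p y u kappa i => [|p s IH] y u kappa i /=.
  by move=> _ /edge_top_ge.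
rewrite rcons_path last_rcons => /andP[xp /asboolP[v [la [j e']]]] e.
have le0 := edge_guard e (edge_name e') (edge_up e').
apply: (le_trans le0); apply: le_trans (IH _ _ _ _ xp e').
exact: name_le_mono (edge_name e') _.
Qed.

(** The end vertex determines its ladder by [tau_inj]. A last step through rung [i.+1] forces
    [top x] into the interval from [kappa i] to [kappa i.+1]; these half-open intervals are
    disjoint, so both walks use the same rung. *)
Lemma walk_uniq x p q : walk x p -> walk x q -> last x p = last x q -> p = q.
Proof.
have noloop r s : walk x (rcons r s) -> x <> s.
  rewrite rcons_path => /andP[/walk_le xr /asboolP/edge_lt rs] xs.
  by have := le_lt_trans xr rs; rewrite xs ltxx.
elim/last_ind: p q => [|p y IH] q; case/lastP: q => [|q y'] //.
- by move=> _ /noloop h; rewrite last_rcons.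
- by move=> /noloop h _; rewrite last_rcons => /esym.
rewrite !last_rcons !rcons_path => /andP[xp /asboolP e] /andP[xq /asboolP e'] yy'.
subst y'; congr rcons; apply: IH => //.
case: e e' => [u [k [i e]]] [u' [k' [i' e']]].
have tt : tau u k = tau u' k' by rewrite -(edge_up e) -(edge_up e').
have [uu kk] := tau_inj (edge_name e) (edge_name e') tt; subst u' k'.
suff ii : i = i' by rewrite (edge_down e) (edge_down e') ii.
have up r j z : walk x r -> edge_at u k j (last x r) z -> top x < k j.+1.
  by move=> /walk_le xr /edge_top_lt; exact: le_lt_trans.
apply/anti_leq/andP; split; rewrite -ltnS; apply: (name_lt_inj (edge_name e)).
  exact: le_lt_trans (walk_ge xp e) (up _ _ _ xq e').
exact: le_lt_trans (walk_ge xq e') (up _ _ _ xp e).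
Qed.

Lemma next_rung_le u kappa i s t u' lambda j t' :
  edge_at u kappa i s t -> edge_at u' lambda j s t' ->
  u' (kappa i.+1) -> lambda j.+1 <= kappa i.+1.
Proof.
move=> e e' u'k; rewrite leNgt; apply/negP => kl.
have : s (kappa i.+1) by rewrite (edge_down e').
by rewrite (edge_down e) /= => -[_]; rewrite /= ltxx.
Qed.

(* Infinitely many common lower neighbours give [t] and [t'] infinitely many
   common rungs, hence the same ladder and the same union below it. *)
Lemma infinite_lower_nbrs (Q : set (set W)) t t' : infinite_set Q ->
  (forall s, Q s -> edge s t /\ edge s t') -> t = t'.
Proof.
(* Each index of the ladder yields one lower neighbour, so infinitely many neighbours use
   arbitrarily high rungs. *)
have high (Q' : set (set W)) u k tt : infinite_set Q' -> name u k -> tt = tau u k ->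
    (forall s, Q' s -> edge s tt) ->
    forall n, exists s i, [/\ Q' s, (n <= i)%N & edge_at u k i s tt].
  move=> infQ nk ttE h n; apply: contrapT => no; apply: infQ.
  apply: (@sub_finite_set _ _ [set u `&` [set x | x < k i.+1] | i in `I_n]).
    move=> s Qs; have [u' [k' [i e]]] := h s Qs.
    have tt' : tau u k = tau u' k' by rewrite -ttE (edge_up e).
    have [uu kk] := tau_inj nk (edge_name e) tt'; subst u' k'.
    exists i; last by rewrite (edge_down e).
    by rewrite /= ltnNge; apply/negP => ni; apply: no; exists s, i.
  exact: finite_image (finite_II n).
move=> infQ hQ.
have [s0 Qs0] := infinite_setN0 infQ.
have [[u [k [i0 e0]]] [u' [k' [j0 f0]]]] := hQ _ Qs0.
have nk := edge_name e0; have nk' := edge_name f0.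
have both s : Q s -> exists i j, edge_at u k i s t /\ edge_at u' k' j s t'.
  move=> /hQ[[v [l [i e]]] [v' [l' [j f]]]]; exists i, j.
  have te : tau u k = tau v l by rewrite -(edge_up e) -(edge_up e0).
  have tf : tau u' k' = tau v' l' by rewrite -(edge_up f) -(edge_up f0).
  have [uv kl] := tau_inj nk (edge_name e) te.
  have [uv' kl'] := tau_inj nk' (edge_name f) tf.
  by subst v l v' l'.
have hi := high Q u k t infQ nk (edge_up e0) (fun s Qs => (hQ s Qs).1).
have hi' := high Q u' k' t' infQ nk' (edge_up f0) (fun s Qs => (hQ s Qs).2).
(* A lower neighbour cut high enough in [u] contains [k i], and it is also contained in [u']. *)
have kin i : u' (k i).
  have [s [i' [Qs ii' e]]] := hi i; have [_ [j [_ f]]] := both s Qs.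
  have : s (k i).
    rewrite (edge_down e); split; first exact: name_in nk i.
    exact: (name_lt_mono nk).
  by rewrite (edge_down f) => -[].
have kin' i : u (k' i).
  have [s [i' [Qs ii' e]]] := hi' i; have [j [_ [f _]]] := both s Qs.
  have : s (k' i).
    rewrite (edge_down e); split; first exact: name_in nk' i.
    exact: (name_lt_mono nk').
  by rewrite (edge_down f) => -[].
(* With each ladder inside the other union, [next_rung_le] applies both ways: the rungs at which [s]
   is cut coincide, and so do all rungs below them. *)
have kk : k = k'.
  apply/funext => n; have [s [i [Qs ni e]]] := hi n.
  have [_ [j [_ f]]] := both s Qs.
  have kij : k i.+1 = k' j.+1.
    apply/le_anti/andP; split; first exact: next_rung_le f e (kin' _).
    exact: next_rung_le e f (kin _).
  by have [_ h] := name_rungs nk nk' kij; apply: h; exact: leqW.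
subst k'; have uu := name_top nk nk'.
suff uu' : u = u' by rewrite (edge_up e0) (edge_up f0) uu'.
(* The cuts [s] exhaust [v] below its top, and the tops agree because the ladders do. *)
have sub v v' (nv : name v k) (nv' : name v' k) :
    (forall n, exists s i, [/\ Q s, (n <= i)%N, s = v `&` [set x | x < k i.+1] & s `<=` v']) ->
    v `<=` v'.
  move=> h x vx; have := le_top hW w0 (name_node nv) vx.
  rewrite le_eqVlt => /predU1P[->|/(name_cofinal nv)[n xn]].
    by rewrite (name_top nv nv'); exact: (top_in hW w0 (name_node nv')).
  have [s [i [_ ni sE]]] := h n; apply; rewrite sE; split=> //=.
  by apply: (lt_le_trans xn); apply: (name_le_mono nv); exact: leqW.
apply/seteqP; split; apply: sub => // n.
  have [s [i [Qs ni e]]] := hi n; have [_ [j [_ f]]] := both s Qs.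
  by exists s, i; split=> //; [exact: edge_down e | rewrite (edge_down f) => x []].
have [s [i [Qs ni e]]] := hi' n; have [j [_ [f _]]] := both s Qs.
by exists s, i; split=> //; [exact: edge_down e | rewrite (edge_down f) => x []].
Qed.

Definition ladder_adj : rel (set W) := fun s t => `[< edge s t \/ edge t s >].

Lemma ladder_adj_sym : symmetric ladder_adj.
Proof. by move=> s t; apply/asboolP/asboolP => -[]; [right|left|right|left]. Qed.

Lemma ladder_adj_irrefl : irreflexive ladder_adj.
Proof. by move=> s; apply/asboolP => -[] /edge_lt; rewrite ltxx. Qed.

Lemma ladder_adj_node s t : ladder_adj s t -> node s.
Proof. by move=> /asboolP[] /edge_nodes[]. Qed.

Definition ladder_graph : graph (set W) :=
  Graph ladder_adj_sym ladder_adj_irrefl ladder_adj_node.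

Lemma ladder_subgraph :
  subgraph ladder_graph (comparability_graph (closed_subsets S) init).
Proof.
split; first by move=> t [].
move=> s t /asboolP st; apply/asboolP.
have [ns nt] : node s /\ node t by case: st => /edge_nodes[].
split; [by case: ns|by case: nt| |].
  by move=> e; case: st => /edge_lt; rewrite e ltxx.
by case: st => /edge_init ->; rewrite ?orbT.
Qed.

Lemma ladder_colorable : colorable ladder_graph [set: W].
Proof.
exists top; split=> // s t /asboolP[] /edge_lt + e; by rewrite e ltxx.
Qed.

(** Without a directed cycle, since tops increase, a triangle gives a one-step and a two-step walk
    with the same ends. *)
Lemma ladder_no_triangle : ~ has_triangle ladder_graph.
Proof.
have tri x y z : edge x y -> edge y z -> edge x z -> False.
  move=> xy yz xz; have : [:: y; z] = [:: z].
    by apply: (@walk_uniq x); rewrite //= !asboolT.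
  by [].
move=> [x [y [z [/asboolP[xy|yx] /asboolP[yz|zy] /asboolP[zx|xz]]]]].
- have := lt_trans (edge_lt xy) (lt_trans (edge_lt yz) (edge_lt zx)); by rewrite ltxx.
- exact: tri xy yz xz.
- exact: tri zx xy zy.
- exact: tri xz zy xy.
- exact: tri yz zx yx.
- exact: tri yx xz yz.
- exact: tri zy yx zx.
- have := lt_trans (edge_lt zy) (lt_trans (edge_lt yx) (edge_lt xz)); by rewrite ltxx.
Qed.

End LadderGraph.

(** * Edges of paths and cycles *)

Section PathEdges.
Context (U : eqType).
Implicit Types (p q c : seq U) (x u v : U).

Lemma mem_zip_behead p u v :
  (u, v) \in zip p (behead p) <-> exists p1 p2, p = p1 ++ [:: u, v & p2].
Proof.
elim: p => [|x [|y p] IH].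
- by split=> // -[[|? ?] [? ?]].
- by split=> // -[[|? [|? ?]] [? ?]].
rewrite -[zip _ _]/((x, y) :: zip (y :: p) p) inE; split.
  move=> /predU1P[[-> ->]|/IH[p1 [p2 ->]]]; first by exists [::], p.
  by exists (x :: p1), p2.
move=> [[|x1 p1] [p2 /= e]]; apply/orP.
  by left; case: e => -> -> _.
by right; apply/IH; exists p1, p2; case: e.
Qed.

Lemma path_edgeP p u v : path_edge p u v <->
  (exists p1 p2, p = p1 ++ [:: u, v & p2]) \/ (exists p1 p2, p = p1 ++ [:: v, u & p2]).
Proof.
rewrite -!mem_zip_behead /path_edge; split=> [/orP//|]; by move=> /orP.
Qed.

Lemma path_edge_rev p u v : path_edge (rev p) u v = path_edge p u v.
Proof.
suff h q : path_edge q u v -> path_edge (rev q) u v.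
  by apply/idP/idP => [/h|/h//]; rewrite revK.
move=> /path_edgeP qE; apply/path_edgeP; case: qE => -[p1 [p2 ->]]; [right|left].
  by exists (rev p2), (rev p1); rewrite rev_cat !rev_cons -!cats1 -!catA.
by exists (rev p2), (rev p1); rewrite rev_cat !rev_cons -!cats1 -!catA.
Qed.

Lemma path_edge_mem p u v : path_edge p u v -> u \in p.
Proof.
by move=> /path_edgeP[] [p1 [p2 ->]]; rewrite mem_cat !inE eqxx ?orbT.
Qed.

Lemma path_edge_head x p u : uniq (x :: p) -> path_edge (x :: p) x u -> u = head x p.
Proof.
move=> /= /andP[xp _] /path_edgeP[] [[|y p1] [p2 /= e]].
- by case: e => ->.
- by case: e xp => _ ->; rewrite mem_cat mem_head orbT.
- by case: e xp => _ ->; rewrite mem_head.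
- by case: e xp => _ ->; rewrite mem_cat !inE eqxx !orbT.
Qed.

Lemma path_edge_last x p u v : uniq (x :: p) ->
  path_edge (x :: p) (last x p) u -> path_edge (x :: p) (last x p) v -> u = v.
Proof.
rewrite -rev_uniq -!(path_edge_rev (x :: p)) [x :: p]lastI rev_rcons => un.
by move=> /(path_edge_head un) -> /(path_edge_head un) ->.
Qed.

Lemma cycle_two_edges c x : (2 < size c)%N -> uniq c -> x \in c ->
  exists u v, [/\ u <> v, cycle_edge c x u & cycle_edge c x v].
Proof.
move=> c2 uc xc; case/splitPr: c / xc c2 uc => c1 c2.
(* The cases are: [x] opens the list, closes it, or lies inside; in the first two, one of the edges
   is the closing edge. *)
case/lastP: c1 => [|c1 a].
  case: c2 => [|a c2] //; case/lastP: c2 => [|c2 b] //= _.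
  move=> /and3P[_ ac2 _]; exists a, b; split.
  - by move=> ab; move: ac2; rewrite ab mem_rcons mem_head.
  - by apply/path_edgeP; left; exists [::], (rcons (rcons c2 b) x).
  - by apply/path_edgeP; right; exists [:: x, a & c2], [::]; rewrite /= -!cats1 -!catA.
case: c2 => [|b c2].
  case: c1 => [|b c1] // _.
  rewrite cat_uniq => /andP[/= /andP[bc1 _] _].
  exists a, b; split.
  - by move=> ab; move: bc1; rewrite -ab mem_rcons mem_head.
  - by apply/path_edgeP; right; exists (b :: c1), [:: b]; rewrite /= -!cats1 -!catA.
  - by apply/path_edgeP; left; exists (b :: rcons c1 a), [::]; rewrite /= -!cats1 -!catA.
move=> _; rewrite cat_uniq => /and3P[_ disj _].
exists a, b; split.
- move=> ab; move: disj => /hasPn/(_ b); rewrite !inE eqxx orbT => /(_ isT).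
  by rewrite -ab mem_rcons mem_head.
- case: c1 {disj} => [|y c1]; apply/path_edgeP; right.
    by exists [::], (rcons (b :: c2) a).
  by exists (y :: c1), (rcons (b :: c2) y); rewrite /= -!cats1 -!catA.
- case: c1 {disj} => [|y c1]; apply/path_edgeP; left.
    by exists [:: a], (rcons c2 a).
  by exists (rcons (y :: c1) a), (rcons c2 y); rewrite /= -!cats1 -!catA.
Qed.

End PathEdges.

(** * Excluding special cycles and the graph H *)

Section Excluded.
Context (d : Order.disp_t) (W : orderTopologicalType d) (hW : is_omega1 W).
Context (S : set W) (w0 : W) (phi : W -> W).
Context (tau : set W -> (nat -> W) -> set W).
Hypothesis tauP : forall u kappa, name S w0 phi u kappa ->
  [/\ node S (tau u kappa), initial_segment u (tau u kappa) &
      code w0 phi (tau u kappa) = range kappa].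

Implicit Types (s t u v x y : set W).

Local Notation top := (top w0).
Local Notation edge := (edge S w0 phi tau).
Local Notation X := (ladder_graph hW tauP).
Local Notation walk := (path (fun s t => `[< edge s t >])).

Lemma ascending_walk x p :
  sorted (adj X) (x :: p) -> sorted (lt_of (@initial_segment d W)) (x :: p) ->
  walk x p.
Proof.
elim: p x => //= y p IH x /andP[/asboolP xy yp] /andP[/andP[nxy ixy] ip].
rewrite IH // andbT; apply/asboolP; case: xy => // /(edge_init tauP) iyx.
by case/eqP: nxy; exact: init_anti.
Qed.

Lemma walk_lt x p : walk x p -> p != [::] -> top x < top (last x p).
Proof.
case: p => //= y p /andP[/asboolP/(edge_lt hW tauP) xy /(walk_le hW tauP) yp] _.
exact: lt_le_trans yp.
Qed.

Lemma walk_mem x p z : walk x p -> z \in x :: p ->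
  (z = x \/ top x < top z) /\ (z = last x p \/ top z < top (last x p)).
Proof.
move=> + zp; case/splitPl: zp => p1 p2 <-.
rewrite cat_path last_cat => /andP[w1 w2]; split.
  by case: p1 w1 {w2} => [|y p1] w1; [left|right; exact: walk_lt].
by case: p2 w2 => [|y p2] w2; [left|right; exact: walk_lt].
Qed.

(** An end of one path has a single edge there but two in the cycle, so it lies on the other path
    too. The paths then share both ends and coincide by [walk_uniq], leaving their first vertex with
    one edge only. *)
Lemma no_ascending_cycle c p q : is_cycle X c ->
  is_path X p -> sorted (lt_of (@initial_segment d W)) p ->
  is_path X q -> sorted (lt_of (@initial_segment d W)) q ->
  (forall x, (x \in c) = (x \in p) || (x \in q)) ->
  (forall x y, cycle_edge c x y = path_edge p x y || path_edge q x y) -> False.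
Proof.
move=> [c2 /andP[_ uc]].
case: p => [|x p] [//= _ _ up sp] ip.
case: q => [|y q] [//= _ _ uq sq] iq mem edg.
have wp := ascending_walk sp ip; have wq := ascending_walk sq iq.
have share r r' z : (forall z, (z \in c) = (z \in r) || (z \in r')) ->
    (forall u v, cycle_edge c u v = path_edge r u v || path_edge r' u v) ->
    z \in r -> (forall u v, path_edge r z u -> path_edge r z v -> u = v) ->
    z \in r'.
  move=> memr edgr zr zu.
  have [|u [v [uv]]] := @cycle_two_edges _ c z c2 uc; first by rewrite memr zr.
  rewrite !edgr => /orP[zu1|/path_edge_mem//] /orP[zv1|/path_edge_mem//].
  by case: uv; exact: zu.
have mem' z : (z \in c) = (z \in y :: q) || (z \in x :: p) by rewrite orbC mem.
have edg' u v : cycle_edge c u v = path_edge (y :: q) u v || path_edge (x :: p) u v.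
  by rewrite orbC edg.
have hd r z : uniq (z :: r) -> forall u v,
    path_edge (z :: r) z u -> path_edge (z :: r) z v -> u = v.
  by move=> ur u v /(path_edge_head ur) -> /(path_edge_head ur) ->.
have lst r z : uniq (z :: r) -> forall u v, path_edge (z :: r) (last z r) u ->
    path_edge (z :: r) (last z r) v -> u = v.
  by move=> ur u v; exact: path_edge_last.
have xq := share _ _ x mem edg (mem_head _ _) (hd _ _ up).
have yp := share _ _ y mem' edg' (mem_head _ _) (hd _ _ uq).
have lq := share _ _ _ mem edg (mem_last _ _) (lst _ _ up).
have lp := share _ _ _ mem' edg' (mem_last _ _) (lst _ _ uq).
have xy : x = y.
  have [[//|xy] _] := walk_mem wp yp; have [[//|yx] _] := walk_mem wq xq.
  by have := lt_trans xy yx; rewrite ltxx.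
have ll : last x p = last y q.
  have [_ [//|l1]] := walk_mem wq lq; have [_ [//|l2]] := walk_mem wp lp.
  by have := lt_trans l1 l2; rewrite ltxx.
subst y; have pq := walk_uniq hW tauP wp wq ll; subst q.
have [|u [v [uv]]] := @cycle_two_edges _ c x c2 uc; first by rewrite mem mem_head.
by rewrite !edg !orbb => xu xv; apply: uv; exact: hd xu xv.
Qed.

Lemma ladder_no_special_cycle (c : seq (set W)) :
  ~ special_cycle (@initial_segment d W) X c.
Proof.
(* Descending paths are reversed; vertices and edges stay the same. *)
have asc p : is_path X p -> monotone (@initial_segment d W) p ->
    exists p', [/\ is_path X p', sorted (lt_of (@initial_segment d W)) p',
      p' =i p & forall x y, path_edge p' x y = path_edge p x y].
  move=> pp [sp|sp]; first by exists p.
  exists (rev p); split.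
  - case: pp => p0 pv up ap; split.
    + by rewrite -size_eq0 size_rev size_eq0.
    + by move=> x; rewrite mem_rev; exact: pv.
    + by rewrite rev_uniq.
    + by rewrite rev_sorted; apply: sub_sorted ap => s t; rewrite adj_sym.
  - by rewrite rev_sorted.
  - exact: mem_rev.
  - by move=> x y; rewrite path_edge_rev.
move=> [cc [p [q [[pp mp] [qq mq] mem edg]]]].
have [p' [pp' sp' memp edgp]] := asc p pp mp.
have [q' [qq' sq' memq edgq]] := asc q qq mq.
apply: (no_ascending_cycle cc pp' sp' qq' sq') => [x|x y].
  by rewrite mem memp memq.
by rewrite edg edgp edgq.
Qed.

Lemma few_lower_nbrs (g : nat -> set W) t t' : injective g -> t <> t' ->
  exists N, forall k, (N <= k)%N -> edge (g k) t -> edge (g k) t' -> False.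
Proof.
move=> ginj tt'; apply: contrapT => no; apply: tt'.
apply: (infinite_lower_nbrs hW tauP (Q := [set s | edge s t /\ edge s t'])) => // fin.
have : finite_set [set k | edge (g k) t /\ edge (g k) t'].
  have -> : [set k | edge (g k) t /\ edge (g k) t'] =
      g @^-1` [set s | edge s t /\ edge s t'] by [].
  by apply: finite_preimage fin => x y _ _; exact: ginj.
move=> /finite_seqP[r rE]; apply: no; exists (\max_(i <- r) i).+1 => k rk e e'.
have : k \in r by have : [set` r] k by rewrite -rE.
by move=> kr; have := leq_bigmax_seq (F := id) k kr isT; rewrite leqNgt rk.
Qed.

(** All but finitely many [x i] lie above [z] or [z'], so three of them lie above the same one. A
    late [y j] cannot lie below two of these three, hence lies above two, and two walks with the
    same ends appear. *)
Lemma ladder_no_H : ~ has_subgraph_iso X H_graph.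
Proof.
move=> [Y [_ YX] [f [_ finj fsurj] fadj]].
have /choice[g gP] : forall h, exists v, verts Y v /\ f v = h.
  by move=> h; have [v Yv <-] := fsurj h I; exists v.
have ginj : injective g by move=> h h' e; rewrite -(gP h).2 -(gP h').2 e.
have gadj h h' : H_adj h h' -> edge (g h) (g h') \/ edge (g h') (g h).
  move=> hh; apply/asboolP; apply: YX.
  by rewrite fadj; [rewrite (gP h).2 (gP h').2|exact: (gP h).1|exact: (gP h').1].
pose x i := g (Hx i); pose y i := g (Hy i).
have xinj : injective x by move=> i j /ginj[].
have yinj : injective y by move=> i j /ginj[].
have xz i : edge (x i) (g Hz) \/ edge (g Hz) (x i) by exact: gadj.
have xz' i : edge (x i) (g Hz') \/ edge (g Hz') (x i) by exact: gadj.
have xy i j : (i <= j)%N -> edge (x i) (y j) \/ edge (y j) (x i).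
  by move=> ij; apply: gadj; rewrite /H_adj /= ij.
have no2 w i1 i2 j : i1 <> i2 -> edge w (x i1) -> edge w (x i2) ->
    edge (x i1) (y j) -> edge (x i2) (y j) -> False.
  move=> i12 w1 w2 y1 y2; apply: i12; apply: xinj.
  have : [:: x i1; y j] = [:: x i2; y j].
    by apply: (walk_uniq hW tauP (x := w)); rewrite //= !asboolT.
  by case.
have no3 w i1 i2 i3 : i1 <> i2 -> i1 <> i3 -> i2 <> i3 ->
    edge w (x i1) -> edge w (x i2) -> edge w (x i3) -> False.
  move=> i12 i13 i23 w1 w2 w3.
  have few i i' : i <> i' -> exists N, forall k, (N <= k)%N ->
      edge (y k) (x i) -> edge (y k) (x i') -> False.
    by move=> ii; apply: few_lower_nbrs => // /xinj.
  have [n12 h12] := few _ _ i12; have [n13 h13] := few _ _ i13.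
  have [n23 h23] := few _ _ i23.
  (* Large enough to pass the three thresholds and to be adjacent in H to all three [x]. *)
  pose j := (n12 + n13 + n23 + i1 + i2 + i3)%N.
  have [j12 [j13 [j23 [j1 [j2 j3]]]]] : (n12 <= j)%N /\ (n13 <= j)%N /\ (n23 <= j)%N /\
    (i1 <= j)%N /\ (i2 <= j)%N /\ (i3 <= j)%N.
    by rewrite /j; do !split; rewrite -?addnA;
      do ?[exact: leq_addr|apply: leq_trans (leq_addl _ _)].
  case: (xy i1 j j1) => e1; case: (xy i2 j j2) => e2; case: (xy i3 j j3) => e3;
  first [ exact: (h12 _ j12 e1 e2) | exact: (h13 _ j13 e1 e3)
        | exact: (h23 _ j23 e2 e3) | exact: (no2 _ _ _ _ i12 w1 w2 e1 e2)
        | exact: (no2 _ _ _ _ i13 w1 w3 e1 e3) | exact: (no2 _ _ _ _ i23 w2 w3 e2 e3) ].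
have [|N hN] := few_lower_nbrs (g := x) (t := g Hz) (t' := g Hz') xinj.
  by move=> /ginj.
have up k : edge (g Hz) (x (N + k)%N) \/ edge (g Hz') (x (N + k)%N).
  case: (xz (N + k)%N) => [e|]; last by left.
  case: (xz' (N + k)%N) => [e'|]; last by right.
  by case: (hN _ (leq_addr _ _) e e').
have ne a b : a <> b -> (N + a)%N <> (N + b)%N by move=> ab /addnI.
(* Pigeonhole: five vertices above two possible ones put three above the same. *)
case: (up 0%N) => u0; case: (up 1%N) => u1; case: (up 2%N) => u2;
case: (up 3%N) => u3; case: (up 4%N) => u4;
match goal with
| _ : edge ?w (x (N + ?i)%N), _ : edge ?w (x (N + ?j)%N),
  _ : edge ?w (x (N + ?k)%N) |- _ =>
  by apply: (no3 w (N + i)%N (N + j)%N (N + k)%N) => //; exact: ne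
end.
Qed.

End Excluded.

(** * Uncountable chromatic number *)

Section Uncountable.
Context (d : Order.disp_t) (W : orderTopologicalType d) (hW : is_omega1 W).
Context (S : set W) (hS : stationary S) (w0 : W) (phi : W -> W).
Context (tau : set W -> (nat -> W) -> set W).
Hypothesis phiP : forall a b, exists c, [/\ S c, b < c & phi c = a].
Hypothesis tauP : forall u kappa, name S w0 phi u kappa ->
  [/\ node S (tau u kappa), initial_segment u (tau u kappa) &
      code w0 phi (tau u kappa) = range kappa].

Implicit Types (q s t u v : set W) (kappa lambda : nat -> W).

Local Notation init := (@initial_segment d W).
Local Notation node := (node S).
Local Notation top := (top w0).
Local Notation name := (name S w0 phi).
Local Notation edge := (edge S w0 phi tau).

Lemma no_nat_coloring (f : set W -> nat) :
  exists s t, edge s t /\ f s = f t.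
Proof.
(* The last clause keeps the bottom rung of any ladder naming [s] above [q]; with [q] the stage
   topped by a rung, this will give [edge_guard]. *)
pose P n q := exists s, [/\ node s, init q s, f s = n &
  forall v lambda, name v lambda -> s = tau v lambda ->
  forall x, q x -> x <= lambda 0%N].
have Pdown n q q' : init q q' -> P n q' -> P n q.
  move=> qq' [s [ns q's fs hs]]; exists s; split=> //; first exact: init_trans q's.
  by move=> v la nv sv x qx; apply: hs nv sv _ _; exact: (init_sub qq').
pose D n q := ~ P n q \/ forall q', node q' -> init q q' -> P n q'.
have [c0 Sc0 _] := stationary_unbounded hW hS w0.
have [||ts [nts _ tsD]] := @distributive _ _ hW _ hS w0 D _ (node1 hW Sc0).
- move=> n q nq; have [allP|] := pselect (forall q', node q' -> init q q' -> P n q').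
    by exists q; split=> //; [exact: init_refl|right].
  move=> /existsNP[q' /not_implyP[nq' /not_implyP[qq' nP]]].
  by exists q'; split=> //; left.
- move=> n q q' nq nq' qq' [nP|allP]; [left|right].
    by move=> /(Pdown n _ _ qq').
  by move=> q2 nq2 q'q2; apply: allP => //; exact: init_trans q'q2.
pose dense n := forall q, node q -> init ts q -> P n q.
have [b1 [tsb1 wb1]] := above_two hW (top ts) w0.
(* The future bottom rung: [name_zero] asks for [phi]-value [w0] and a place above [w0], and it must
   also exceed all of [ts]. *)
have [b0 [Sb0 b1b0 pb0]] := phiP w0 b1.
have [nq0 tsq0 topq0] := node_add hW nts Sb0 (lt_trans tsb1 b1b0).
pose R k q q' := exists s b, [/\ node s, init q s, S b, top s < b & phi b = top q] /\
  [/\ q' = s `|` [set b], dense k -> f s = k & dense k ->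
    forall v lambda, name v lambda -> s = tau v lambda -> top q <= lambda 0%N].
have [|k q b [nq tsq]|c [g [Sc g0 gP cof]]] := @chase _ _ hW _ hS _ top
    (fun q => node q /\ init ts q) R (ts `|` [set b0]).
- by [].
- have [s [ns qs fs hs]] : exists s, [/\ node s, init q s, dense k -> f s = k & dense k ->
      forall v lambda, name v lambda -> s = tau v lambda -> top q <= lambda 0%N].
    have [dk|ndk] := pselect (dense k); last first.
      (* For a colour not of the second kind any node serves, so the ladder just continues from
         [q]. *)
      by exists q; split=> //; exact: init_refl.
    have [s [ns qs fs hs]] := dk q nq tsq.
    exists s; split=> // _ v la nv sv; apply: hs nv sv _ _; exact: (top_in hW w0 nq).
  have [b' [bb' sb']] := above_two hW b (top s).
  have [c [Sc b'c pc]] := phiP (top q) b'.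
  have sc := lt_trans sb' b'c.
  have [nsc ssc topsc] := node_add hW ns Sc sc.
  exists (s `|` [set c]); split.
  + by split=> //; apply: init_trans ssc; exact: init_trans qs.
  + by exists s, c.
  + by rewrite topsc (lt_trans bb').
have ng k : node (g k) by case: (gP k) => -[].
have gi k : init (g k) (g k.+1).
  case: (gP k) => _ [s [b [[ns gs Sb sb _] [-> _ _]]]] _.
  by have [_ sg _] := node_add hW ns Sb sb; exact: init_trans gs sg.
have gc k : top (g k) < c by case: (gP k).
have := node_limit hW Sc ng gi gc cof.
set u := _ `|` _ => -[nu gu topu].
pose kappa k := top (g k).
have nk : name u kappa.
  split=> //.
  - by move=> i; apply: (init_sub (gu i)); exact: (top_in hW w0 (ng i)).
  - move=> i; rewrite /kappa; case: (gP i) => _ [s [b [[ns gs Sb sb _] [-> _ _]]]] _.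
    have [_ _ ->] := node_add hW ns Sb sb.
    by apply: le_lt_trans sb; exact: (init_top hW w0 (ng i) ns gs).
  - move=> i; rewrite /kappa; case: (gP i) => _ [s [b [[ns gs Sb sb pb] [-> _ _]]]] _.
    by have [_ _ ->] := node_add hW ns Sb sb.
  - by rewrite /kappa g0 topq0 pb0 (lt_trans wb1).
  - by move=> i; rewrite topu; exact: gc.
  - by move=> x; rewrite topu; exact: cof.
have [nt ut _] := tauP nk.
set t := tau u kappa in nt ut.
have tst : init ts t.
  apply: init_trans ut; apply: init_trans (gu 0%N); rewrite g0; exact: tsq0.
(* The first alternative fails because [t] itself is a witness: by [tau_inj] its only ladder is
   [kappa], which starts at [b0], above [ts]. *)
have dft : dense (f t).
  case: (tsD (f t)) => // -[]; exists t; split=> // v la nv /(tau_inj hW tauP nk nv)[_ <-].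
  move=> x tsx; rewrite /kappa g0 topq0.
  apply: (le_trans (le_top hW w0 nts tsx)); exact: ltW (lt_trans tsb1 b1b0).
(* Stage number [f t] of the construction inserted a vertex [s] of colour [f t], ending just below
   the next rung. *)
have [_ [s [b [[ns gs Sb sb pb] [gE fs hs]]]] _] := gP (f t).
exists s, t; split; last exact: fs.
exists u, kappa, (f t); split=> //; last by move=> v la nv sv; exact: hs nv sv.
have topg : top (g (f t).+1) = b by rewrite gE; have [] := node_add hW ns Sb sb.
rewrite /kappa topg; apply/seteqP; split=> x /=.
  move=> sx; split; last exact: le_lt_trans (le_top hW w0 ns sx) sb.
  by apply: (init_sub (gu (f t).+1)); rewrite gE; left.
move=> [ux /= xb]; have : g (f t).+1 x.
  by apply: (init_below_top hW (w0 := w0) (ng _) (gu _) ux); rewrite topg ltW.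
by rewrite gE => -[//|xE]; move: xb; rewrite (xE : x = b) ltxx.
Qed.

Lemma ladder_uncolorable (C : Type) (D : set C) :
  countable D -> ~ colorable (ladder_graph hW tauP) D.
Proof.
move=> /countable_injP[h hinj] [f [fD fX]].
have [s [t [st fst]]] := no_nat_coloring (h \o f).
have [ns nt] := edge_nodes tauP st.
have := fX s t; apply; first by apply/asboolP; left.
by apply: hinj fst; rewrite inE; exact: fD.
Qed.

End Uncountable.

(** * Choice of [phi] and [tau], and the cardinality of colour sets *)

Theorem theorem3 (d : Order.disp_t) (W : orderTopologicalType d)
    (hW : is_omega1 W) (S : set W) (hS : stationary S) :
  exists X : graph (set W),
    [/\ subgraph X (comparability_graph (closed_subsets S) (@initial_segment d W)),
        chromatic_number X [set: W],
        (forall c : seq (set W), ~ special_cycle (@initial_segment d W) X c),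
        ~ has_triangle X &
        ~ has_subgraph_iso X H_graph].
Proof.
have [w0 _] : [set: W] !=set0.
  apply/set0P/eqP => W0; have [_ + _] := hW; apply; rewrite W0; exact: countable0.
have [phi phiP] := unbounded_fibers hW hS.
have /choice[tau tauP] : forall uk : set W * (nat -> W), exists t,
    name S w0 phi uk.1 uk.2 ->
    [/\ node S t, initial_segment uk.1 t & code w0 phi t = range uk.2].
  move=> [u kappa]; have [nk|] := pselect (name S w0 phi u kappa).
    by have [t] := exists_code hW hS phiP nk; exists t.
  (* An arbitrary value where [kappa] is not a ladder in [u]. *)
  by exists u.
pose tau' u kappa := tau (u, kappa).
have tauP' u kappa : name S w0 phi u kappa ->
    [/\ node S (tau' u kappa), initial_segment u (tau' u kappa) &
        code w0 phi (tau' u kappa) = range kappa] by exact: (tauP (u, kappa)).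
exists (ladder_graph hW tauP'); split.
- exact: ladder_subgraph.
- split; first exact: ladder_colorable.
  (* A set of colours that is not countable receives an injection from [W], so ruling out countable
     colourings gives the full lower bound. *)
  move=> C D colD; have [h [hD hinj]] : exists h : W -> C,
      (forall x, D (h x)) /\ injective h.
    apply: (uncountable_inj hW) => cD.
    exact: (ladder_uncolorable hS phiP cD) colD.
  rewrite -(card_le_eql (inj_card_eq (in2W hinj) : (h @` [set: W] #= [set: W])%card)).
  by apply: subset_card_le => _ [x _ <-].
- exact: ladder_no_special_cycle.
- exact: ladder_no_triangle.
- exact: ladder_no_H.
Qed.
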